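(* For a finite group $G$, the non-coprime graph $\Gamma_G$ is connected if and only if the Gruenberg--Kegel graph of $G$ is connected.
   Context: The non-coprime graph $\Gamma_G$ of a finite group $G$ with identity $e$ is the simple undirected graph with vertex set $G\setminus\{e\}$ in which two distinct vertices are adjacent if and only if their orders are not relatively prime. The Gruenberg--Kegel graph of $G$ has as vertices the prime divisors of $|G|$, with distinct primes $p$ and $q$ joined by an edge if and only if $G$ contains an element of order $pq$. *)

(* Defs.v *)
From HB Require Import structures.
From mathcomp Require Import all_boot all_fingroup.
Set Implicit Arguments.
Unset Strict Implicit.
Unset Printing Implicit Defensive.
Import GroupScope.

Record sgraph := SGraph {
  vertex :> finType;
  adj : rel vertex;
  adj_sym : symmetric adj;
  adj_irrefl : irreflexive adj
}.

(* The graph without vertices counts as connected; for the graphs below this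
   only concerns the trivial group, for which both of them are empty. *)
Definition connected_graph (g : sgraph) : Prop :=
  forall x y : g, connect (@adj g) x y.

Section NonCoprimeGraph.
Variables (gT : finGroupType) (G : {group gT}).

Definition noncoprime_adj : rel {x : gT | x \in G^#} :=
  fun x y => (x != y) && ~~ coprime #[val x] #[val y].

Lemma noncoprime_adj_sym : symmetric noncoprime_adj.
Proof. by move=> x y; rewrite /noncoprime_adj eq_sym coprime_sym. Qed.

Lemma noncoprime_adj_irrefl : irreflexive noncoprime_adj.
Proof. by move=> x; rewrite /noncoprime_adj eqxx. Qed.

Definition noncoprime_graph : sgraph :=
  SGraph noncoprime_adj_sym noncoprime_adj_irrefl.

End NonCoprimeGraph.

Section GruenbergKegelGraph.
Variables (gT : finGroupType) (G : {group gT}).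

Definition gk_adj : rel (seq_sub (primes #|G|)) :=
  fun p q => (p != q) && [exists x in G, #[x] == (val p * val q)%N].

Lemma gk_adj_sym : symmetric gk_adj.
Proof. by move=> p q; rewrite /gk_adj eq_sym mulnC. Qed.

Lemma gk_adj_irrefl : irreflexive gk_adj.
Proof. by move=> p; rewrite /gk_adj eqxx. Qed.

Definition gruenberg_kegel_graph : sgraph :=
  SGraph gk_adj_sym gk_adj_irrefl.

End GruenbergKegelGraph.

(* Main.v *)
Require Import Defs.
From HB Require Import structures.
From mathcomp Require Import all_boot all_fingroup all_solvable.
Set Implicit Arguments.
Unset Strict Implicit.
Unset Printing Implicit Defensive.
Import GroupScope.

(** Both graphs are projections of one bipartite graph, in which a prime [p]
    dividing [#|G|] is incident to a nontrivial element [x] of [G] when [p]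
    divides [#[x]].  Two elements are adjacent in the non-coprime graph exactly
    when they are distinct and share an incident prime; two primes are adjacent
    in the Gruenberg-Kegel graph exactly when they are distinct and share an
    incident element, because an element whose order is divisible by [p * q]
    has a power of order [p * q].  No vertex of the bipartite graph is
    isolated: a nontrivial element has a prime divisor of its order, and a
    prime divisor of [#|G|] divides the order of some element by Cauchy's
    theorem.  Hence a walk on either side lifts to the bipartite graph and
    projects to a walk on the other side ([connect_transfer], used once in each
    direction). *)

(** Walks are pushed from [A] to [B] one edge at a time: an [e]-edge passes
    through a common neighbour in [B], and consecutive common neighbours are
    [f]-connected since both are incident to the vertex of [A] between them. *)
Lemma connect_transfer (A B : finType) (e : rel A) (f : rel B)
    (inc : A -> B -> bool) :
    (forall a a', e a a' -> exists2 b, inc a b & inc a' b) ->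
    (forall a b b', inc a b -> inc a b' -> connect f b b') ->
  forall a a' b b',
    inc a b -> inc a' b' -> connect e a a' -> connect f b b'.
Proof.
move=> e_inc inc_f a a' b b' ab a'b' /connectP[s es a'E].
rewrite {}a'E in a'b'; elim: s a b ab es a'b' => [|c s IHs] a b ab /=.
  by move=> _; apply: inc_f ab.
case/andP=> /e_inc[d ad cd] es lastb'.
exact: connect_trans (inc_f _ _ _ ab ad) (IHs _ _ cd es lastb').
Qed.

Lemma noncoprime_common_prime (m n : nat) :
  0 < m -> ~~ coprime m n -> exists p, [/\ prime p, p %| m & p %| n].
Proof.
move=> m_gt0 ncop; exists (pdiv (gcdn m n)).
have g_gt1: 1 < gcdn m n by rewrite ltn_neqAle eq_sym ncop gcdn_gt0 m_gt0.
have := pdiv_dvd (gcdn m n); rewrite dvdn_gcd => /andP[-> ->].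
by rewrite pdiv_prime.
Qed.

Lemma common_prime_noncoprime (p m n : nat) :
  prime p -> p %| m -> p %| n -> ~~ coprime m n.
Proof.
move=> p_pr pm pn; apply/negP => /eqP g1.
by have := dvdn_gcd p m n; rewrite g1 pm pn dvdn1 => /eqP p1; rewrite p1 in p_pr.
Qed.

Section Incidence.
Variables (gT : finGroupType) (G : {group gT}).

Let elt : finType := noncoprime_graph G.
Let prm : finType := gruenberg_kegel_graph G.

Definition prime_divides_order (p : prm) (x : elt) : bool :=
  ssval p %| #[val x].

Lemma prm_prime (p : prm) : prime (ssval p).
Proof. by have := ssvalP p; rewrite mem_primes => /andP[]. Qed.

Lemma elt_in (x : elt) : val x \in G.
Proof. by have /setD1P[] := valP x. Qed.

Lemma prm_of_order (p : nat) (x : elt) :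
  prime p -> p %| #[val x] ->
  exists2 q : prm, ssval q = p & prime_divides_order q x.
Proof.
move=> p_pr px; have pG: p \in primes #|G|.
  by rewrite mem_primes p_pr cardG_gt0 (dvdn_trans px) ?order_dvdG ?elt_in.
by exists (SeqSub pG).
Qed.

Lemma elt_of_order (x : gT) (p : prm) :
  x \in G -> ssval p %| #[x] ->
  exists2 y : elt, val y = x & prime_divides_order p y.
Proof.
move=> xG px; have x1: x \in G^#.
  rewrite !inE xG andbT; apply: contraTneq px => ->.
  by rewrite order1 dvdn1; apply: contraTneq (prm_prime p) => ->.
by exists (exist _ x x1).
Qed.

Lemma prm_incident (p : prm) : exists x, prime_divides_order p x.
Proof.
have := ssvalP p; rewrite mem_primes => /and3P[p_pr _ pG].
have [x xG ox] := Cauchy p_pr pG.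
have px: ssval p %| #[x] by rewrite ox.
by have [y _ ?] := elt_of_order xG px; exists y.
Qed.

Lemma elt_incident (x : elt) : exists p, prime_divides_order p x.
Proof.
have /setD1P[x1 _] := valP x.
have [||p _ ?] := @prm_of_order (pdiv #[val x]) x; last by exists p.
  by rewrite pdiv_prime // order_gt1.
exact: pdiv_dvd.
Qed.

Lemma noncoprime_adj_common (x y : elt) :
  noncoprime_adj x y ->
  exists2 p, prime_divides_order p x & prime_divides_order p y.
Proof.
case/andP=> _ /(noncoprime_common_prime (order_gt0 _))[p [p_pr px py]].
have [q qE qx] := prm_of_order p_pr px.
by exists q; rewrite // /prime_divides_order qE.
Qed.

Lemma gk_adj_common (p q : prm) :
  gk_adj p q ->
  exists2 x, prime_divides_order p x & prime_divides_order q x.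
Proof.
case/andP=> _ /existsP[x /andP[xG /eqP ox]].
have px: ssval p %| #[x] by rewrite ox dvdn_mulr.
have [y yE py] := elt_of_order xG px.
by exists y; rewrite // /prime_divides_order yE ox dvdn_mull.
Qed.

Lemma common_prime_connect (p : prm) (x y : elt) :
  prime_divides_order p x -> prime_divides_order p y ->
  connect (@noncoprime_adj gT G) x y.
Proof.
move=> px py; have [->|xy] := eqVneq x y; first exact: connect0.
apply: connect1; rewrite /noncoprime_adj xy /=.
exact: common_prime_noncoprime (prm_prime p) px py.
Qed.

(** Distinct primes dividing [#[x]] are coprime, so their product divides
    [#[x]], and the power of [x] by the cofactor realizes the edge. *)
Lemma common_elt_connect (x : elt) (p q : prm) :
  prime_divides_order p x -> prime_divides_order q x ->
  connect (@gk_adj gT G) p q.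
Proof.
move=> px qx; have [->|pq] := eqVneq p q; first exact: connect0.
have cop: coprime (ssval p) (ssval q).
  by rewrite prime_coprime ?prm_prime // dvdn_prime2 ?prm_prime //.
have pqx: (ssval p * ssval q)%N %| #[val x] by rewrite Gauss_dvd //; apply/andP.
apply: connect1; rewrite /gk_adj pq /=; apply/existsP.
exists (val x ^+ (#[val x] %/ (ssval p * ssval q))).
rewrite groupX ?elt_in //= orderXdiv ?dvdn_div //.
by rewrite divnA // mulKn ?order_gt0.
Qed.

End Incidence.

Theorem theorem5p1 (gT : finGroupType) (G : {group gT}) :
  connected_graph (noncoprime_graph G) <->
  connected_graph (gruenberg_kegel_graph G).
Proof.
split=> conn.
- move=> p q; have [x px] := prm_incident p; have [y qy] := prm_incident q.
  apply: (connect_transfer (inc := fun x p => prime_divides_order p x))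
    px qy (conn x y).
    exact: noncoprime_adj_common.
  exact: common_elt_connect.
- move=> x y; have [p px] := elt_incident x; have [q qy] := elt_incident y.
  apply: (connect_transfer (inc := @prime_divides_order gT G))
    px qy (conn p q).
    exact: gk_adj_common.
  exact: common_prime_connect.
Qed.
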